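(* For $T>0$ and $c>0$ let $\Sigma_{T,c}$ be the surface parametrized by $X(t,\theta)=c(\cosh t\cos\theta,\ \cosh t\sin\theta,\ t)$, $t\in[-T,T]$, $\theta\in[0,2\pi]$, with unit normal $\nu=\frac{1}{\cosh t}(\cos\theta,\ \sin\theta,\ -\sinh t)$. Then: (i) the free-boundary condition $\langle X,\nu\rangle=0$ along $\partial\Sigma_{T,c}$ determines $T$ uniquely, as the unique positive root of $\cosh T = T\sinh T$; (ii) given this $T$, the radius condition $|X|=1$ along $\partial\Sigma_{T,c}$ fixes $c=\frac{1}{T\cosh T}$; (iii) the Jacobi potential $c^2\cosh^2 t\,|h|^2$ of the (minimal) surface $\Sigma_{T,c}$ equals $\frac{2}{\cosh^2 t}$, that is, writing the potential as $\frac{2\mu}{\cosh^2 t}$ with $\mu\in\mathbb{R}$, one has $\mu=1$. Hence the triple $(T,c,\mu)$ admits no free parameter: there is exactly one triple $(T,c,\mu)$ with $T,c>0$ and $\mu \in\mathbb{R}$ satisfying these conditions.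
   Context: A surface in the closed unit ball $\mathbb{B}^3\subset\mathbb{R}^3$ with boundary on the unit sphere $\partial\mathbb{B}^3$ satisfies the free-boundary condition if it meets $\partial\mathbb{B}^3$ orthogonally, equivalently if the position vector $X$ is tangent to the surface along its boundary, i.e. $\langle X,\nu\rangle=0$ there. The boundary $\partial\Sigma_{T,c}$ consists of the two circles $t=\pm T$. Here $|h|$ is the norm of the second fundamental form of $\Sigma_{T,c}\subset\mathbb{R}^3$. The induced metric is $c^2\cosh^2 t\,(dt^2+d\theta^2)$, so the Jacobi operator $\Delta_\Sigma+|h|^2$ equals $\frac{1}{c^2\cosh^2 t}\big[\partial_{tt}+\partial_{\theta\theta}+c^2\cosh^2 t\,|h|^2\big]$; the function $c^2\cosh^2 t\,|h|^2$ is called the Jacobi potential. The parameter $\mu$ is the strength of the potential when it is written in the form $2\mu/\cosh^2 t$. *)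

(* Defs.v *)
From Stdlib Require Import Reals.
From Coquelicot Require Import Coquelicot.
Open Scope R_scope.

Definition vec3 : Type := (R * R * R)%type.

Definition dot (v w : vec3) : R :=
  let '(v1, v2, v3) := v in let '(w1, w2, w3) := w in
  v1 * w1 + v2 * w2 + v3 * w3.

Definition norm3 (v : vec3) : R := sqrt (dot v v).

(** * Local geometry of a parametrized surface [X : (u1, u2) |-> R^3] *)

Inductive coord : Set := U1 | U2.

Definition sum_coord (f : coord -> R) : R := f U1 + f U2.

(** [Derive] is total; the notions below are meaningful only where the
    parametrization is twice differentiable and immersive, as the catenoid
    below is at every parameter when [0 < c]. *)
Definition Dcoord (i : coord) (f : R -> R -> R) : R -> R -> R :=
  match i with
  | U1 => fun x y => Derive (fun s => f s y) x
  | U2 => fun x y => Derive (fun s => f x s) y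
  end.

Definition partial (i : coord) (X : R -> R -> vec3) : R -> R -> vec3 :=
  fun x y =>
    (Dcoord i (fun a b => fst (fst (X a b))) x y,
     Dcoord i (fun a b => snd (fst (X a b))) x y,
     Dcoord i (fun a b => snd (X a b)) x y).

Definition metric (X : R -> R -> vec3) (x y : R) (i j : coord) : R :=
  dot (partial i X x y) (partial j X x y).

Definition inv_metric (X : R -> R -> vec3) (x y : R) (i j : coord) : R :=
  let g := metric X x y in
  let d := g U1 U1 * g U2 U2 - g U1 U2 * g U2 U1 in
  match i, j with
  | U1, U1 => g U2 U2 / d
  | U1, U2 => - g U1 U2 / d
  | U2, U1 => - g U2 U1 / d
  | U2, U2 => g U1 U1 / d
  end.

Definition second_form (X nu : R -> R -> vec3) (x y : R) (i j : coord) : R :=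
  dot (partial i (partial j X) x y) (nu x y).

(** Trace normalization: the sum, not the average, of the principal
    curvatures. *)
Definition mean_curvature (X nu : R -> R -> vec3) (x y : R) : R :=
  sum_coord (fun i => sum_coord (fun j =>
    inv_metric X x y i j * second_form X nu x y i j)).

(** [|h|^2 = g^{ik} g^{jl} h_{ij} h_{kl}] *)
Definition second_form_normsq (X nu : R -> R -> vec3) (x y : R) : R :=
  sum_coord (fun i => sum_coord (fun j =>
  sum_coord (fun k => sum_coord (fun l =>
    inv_metric X x y i k * inv_metric X x y j l
    * second_form X nu x y i j * second_form X nu x y k l)))).

Definition unit_normal_at (X nu : R -> R -> vec3) (x y : R) : Prop :=
  norm3 (nu x y) = 1 /\ forall i : coord, dot (partial i X x y) (nu x y) = 0.

(** * The catenoid piece [Sigma_{T,c}] *)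

Definition catX (c t theta : R) : vec3 :=
  (c * (cosh t * cos theta), c * (cosh t * sin theta), c * t).

Definition catNu (t theta : R) : vec3 :=
  (/ cosh t * cos theta, / cosh t * sin theta, / cosh t * - sinh t).

Definition param_dom (T t theta : R) : Prop :=
  - T <= t <= T /\ 0 <= theta <= 2 * PI.

(** [theta = 0] and [theta = 2 PI] are glued, so the boundary consists of the
    two circles [t = T] and [t = - T] only. *)
Definition param_bdry (T t theta : R) : Prop :=
  (t = T \/ t = - T) /\ 0 <= theta <= 2 * PI.

Definition free_boundary (T c : R) : Prop :=
  forall t theta : R, param_bdry T t theta ->
    dot (catX c t theta) (catNu t theta) = 0.

Definition radius_condition (T c : R) : Prop :=
  forall t theta : R, param_bdry T t theta -> norm3 (catX c t theta) = 1.

Definition jacobi_potential (c t theta : R) : R :=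
  c ^ 2 * cosh t ^ 2 * second_form_normsq (catX c) catNu t theta.

Definition potential_strength (T c mu : R) : Prop :=
  forall t theta : R, param_dom T t theta ->
    jacobi_potential c t theta = 2 * mu / cosh t ^ 2.

(* Main.v *)
(** The coefficients of the first and second fundamental forms are
    [g = c^2 cosh^2 t I] and [h = diag(c, -c)], which gives minimality and the
    Jacobi potential. On the boundary [<X, nu> = c (cosh T - T sinh T) / cosh T].
    A positive root of [cosh T = T sinh T] exists by the intermediate value
    theorem on [[0, 2]]; two roots [T < S] would give
    [sinh (S - T) = (T - S) sinh T sinh S < 0]. Finally
    [|X|^2 = c^2 (cosh^2 T + T^2)] on the boundary, and [cosh^2 T + T^2 = T^2 cosh^2 T] at the
    root because [cosh^2 - sinh^2 = 1]. *)

Require Import Defs.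
From Stdlib Require Import Reals Lra FunctionalExtensionality.
From Coquelicot Require Import Coquelicot.
Open Scope R_scope.

(** * Hyperbolic and trigonometric identities *)

Lemma cosh_pos (t : R) : 0 < cosh t.
Proof.
  unfold cosh; pose proof (exp_pos t); pose proof (exp_pos (- t)); lra.
Qed.

Lemma cosh_opp (t : R) : cosh (- t) = cosh t.
Proof. unfold cosh; rewrite Ropp_involutive; lra. Qed.

Lemma sinh_opp (t : R) : sinh (- t) = - sinh t.
Proof. unfold sinh; rewrite Ropp_involutive; lra. Qed.

Lemma sinh_pos (t : R) : 0 < t -> 0 < sinh t.
Proof.
  intros Ht; unfold sinh.
  pose proof (exp_increasing (- t) t ltac:(lra)); lra.
Qed.

Lemma cosh2_sinh2 (t : R) : cosh t ^ 2 = 1 + sinh t ^ 2.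
Proof.
  assert (H : exp t * exp (- t) = 1).
  { rewrite <- exp_plus, Rplus_opp_r; exact exp_0. }
  unfold cosh, sinh; nra.
Qed.

Lemma sinh_minus (a b : R) : sinh (a - b) = sinh a * cosh b - cosh a * sinh b.
Proof.
  unfold sinh, cosh.
  replace (- (a - b)) with (- a + b) by ring.
  unfold Rminus; rewrite !exp_plus; field.
Qed.

Lemma cos2_sin2 (x : R) : cos x ^ 2 = 1 - sin x ^ 2.
Proof. pose proof (sin2_cos2 x) as H; unfold Rsqr in H; lra. Qed.

(** * Derivatives of the coordinate functions *)

Lemma is_derive_cosh (t : R) : is_derive cosh t (sinh t).
Proof. apply is_derive_Reals, derivable_pt_lim_cosh. Qed.

Lemma is_derive_sinh (t : R) : is_derive sinh t (cosh t).
Proof. apply is_derive_Reals, derivable_pt_lim_sinh. Qed.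

(** The bracketing [c * (_ * k)] is that of the coordinates of [catX], so that rewriting matches
    them syntactically; likewise for the next lemmas. *)
Lemma Derive_scal_cosh (c k t : R) :
  Derive (fun s => c * (cosh s * k)) t = c * (sinh t * k).
Proof.
  now rewrite Derive_scal, Derive_scal_l, (is_derive_unique _ _ _ (is_derive_cosh t)).
Qed.

Lemma Derive_scal_sinh (c k t : R) :
  Derive (fun s => c * (sinh s * k)) t = c * (cosh t * k).
Proof.
  now rewrite Derive_scal, Derive_scal_l, (is_derive_unique _ _ _ (is_derive_sinh t)).
Qed.

Lemma Derive_scal_cos (c k x : R) :
  Derive (fun s => c * (k * cos s)) x = c * (k * - sin x).
Proof. apply is_derive_unique; auto_derive; [easy | ring]. Qed.

Lemma Derive_scal_sin (c k x : R) :
  Derive (fun s => c * (k * sin s)) x = c * (k * cos x).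
Proof. apply is_derive_unique; auto_derive; [easy | ring]. Qed.

Lemma Derive_scal_opp_sin (c k x : R) :
  Derive (fun s => c * (k * - sin s)) x = c * (k * - cos x).
Proof. apply is_derive_unique; auto_derive; [easy | ring]. Qed.

Lemma Derive_scal_id (c x : R) : Derive (fun s => c * s) x = c.
Proof. apply is_derive_unique; auto_derive; [easy | ring]. Qed.

(** * Fundamental forms and curvature of the catenoid *)

Lemma partial_catX (c : R) (i : coord) :
  partial i (catX c) =
  match i with
  | U1 => fun t theta =>
      (c * (sinh t * cos theta), c * (sinh t * sin theta), c)
  | U2 => fun t theta =>
      (c * (cosh t * - sin theta), c * (cosh t * cos theta), 0)
  end.
Proof.
  (* Equality as functions, not only pointwise, lets the result be rewritten under a second
     [partial]. *)
  destruct i; apply functional_extensionality; intros t;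
    apply functional_extensionality; intros theta;
    unfold partial, Dcoord, catX; cbn [fst snd].
  - now rewrite !Derive_scal_cosh, Derive_scal_id.
  - now rewrite Derive_scal_cos, Derive_scal_sin, Derive_const.
Qed.

Lemma partial2_catX (c : R) (i j : coord) (t theta : R) :
  partial i (partial j (catX c)) t theta =
  match i, j with
  | U1, U1 => (c * (cosh t * cos theta), c * (cosh t * sin theta), 0)
  | U2, U2 => (c * (cosh t * - cos theta), c * (cosh t * - sin theta), 0)
  | _, _ => (c * (sinh t * - sin theta), c * (sinh t * cos theta), 0)
  end.
Proof.
  rewrite partial_catX.
  destruct i, j; unfold partial, Dcoord; cbn [fst snd];
    now rewrite ?Derive_scal_cosh, ?Derive_scal_sinh, ?Derive_scal_cos,
      ?Derive_scal_sin, ?Derive_scal_opp_sin, ?Derive_const.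
Qed.

Lemma metric_catX (c t theta : R) (i j : coord) :
  metric (catX c) t theta i j =
  match i, j with
  | U1, U1 | U2, U2 => c ^ 2 * cosh t ^ 2
  | _, _ => 0
  end.
Proof.
  unfold metric; rewrite !partial_catX.
  destruct i, j; unfold dot; ring [(cosh2_sinh2 t) (cos2_sin2 theta)].
Qed.

Lemma inv_metric_catX (c t theta : R) (i j : coord) :
  0 < c ->
  inv_metric (catX c) t theta i j =
  match i, j with
  | U1, U1 | U2, U2 => / (c ^ 2 * cosh t ^ 2)
  | _, _ => 0
  end.
Proof.
  intros Hc; pose proof (cosh_pos t).
  unfold inv_metric; rewrite !metric_catX.
  destruct i, j; field; lra.
Qed.

Lemma second_form_catX (c t theta : R) (i j : coord) :
  second_form (catX c) catNu t theta i j =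
  match i, j with
  | U1, U1 => c
  | U2, U2 => - c
  | _, _ => 0
  end.
Proof.
  pose proof (cosh_pos t).
  unfold second_form; rewrite partial2_catX.
  destruct i, j; unfold dot, catNu;
    field_simplify_eq; try lra; ring [(cos2_sin2 theta)].
Qed.

Lemma unit_normal_at_catX (c t theta : R) : unit_normal_at (catX c) catNu t theta.
Proof.
  pose proof (cosh_pos t).
  split.
  - unfold norm3; rewrite <- sqrt_1; f_equal.
    unfold dot, catNu; field_simplify_eq; [|lra].
    ring [(cosh2_sinh2 t) (cos2_sin2 theta)].
  - intros i; rewrite partial_catX.
    destruct i; unfold dot, catNu; field_simplify_eq; try lra;
      ring [(cos2_sin2 theta)].
Qed.

Lemma mean_curvature_catX (c t theta : R) :
  0 < c -> mean_curvature (catX c) catNu t theta = 0.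
Proof.
  intros Hc; unfold mean_curvature, sum_coord.
  rewrite !inv_metric_catX, !second_form_catX by assumption; ring.
Qed.

(** Only the two diagonal terms survive, each [c ^ 2 / (c ^ 2 * cosh t ^ 2) ^ 2], so
    [|h|^2 = 2 / (c ^ 2 * cosh t ^ 4)]. *)
Lemma jacobi_potential_eq (c t theta : R) :
  0 < c -> jacobi_potential c t theta = 2 / cosh t ^ 2.
Proof.
  intros Hc; pose proof (cosh_pos t).
  unfold jacobi_potential, second_form_normsq, sum_coord.
  rewrite !inv_metric_catX, !second_form_catX by assumption; field; lra.
Qed.

Lemma potential_strength_iff (T c mu : R) :
  0 < T -> 0 < c -> (potential_strength T c mu <-> mu = 1).
Proof.
  intros HT Hc; split.
  - intros H; pose proof PI_RGT_0.
    (* At [t = 0], where [cosh] is 1, the equation reads [2 = 2 * mu]. *)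
    specialize (H 0 0 ltac:(unfold param_dom; lra)).
    rewrite jacobi_potential_eq, cosh_0 in H by assumption.
    field_simplify in H; lra.
  - intros -> t theta _; rewrite jacobi_potential_eq by assumption.
    now rewrite Rmult_1_r.
Qed.

(** * Free-boundary and radius conditions *)

Lemma dot_catX_catNu (c t theta : R) :
  dot (catX c t theta) (catNu t theta) = c * (cosh t - t * sinh t) / cosh t.
Proof.
  pose proof (cosh_pos t).
  unfold dot, catX, catNu; field_simplify_eq; [|lra].
  ring [(cos2_sin2 theta)].
Qed.

Lemma free_boundary_iff (T c : R) :
  0 < c -> (free_boundary T c <-> cosh T = T * sinh T).
Proof.
  intros Hc; pose proof (cosh_pos T) as HC; split.
  - intros H; pose proof PI_RGT_0.
    (* One boundary point suffices: [<X, nu>] does not depend on [theta]. *)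
    specialize (H T 0 ltac:(unfold param_bdry; lra)).
    rewrite dot_catX_catNu in H.
    apply Rmult_integral in H as [H | H].
    + apply Rmult_integral in H as [H | H]; lra.
    + now destruct (Rinv_neq_0_compat (cosh T) ltac:(lra)).
  - intros H t theta [Ht _]; rewrite dot_catX_catNu.
    (* Both circles behave alike because [cosh t] and [t * sinh t] are even. *)
    destruct Ht as [-> | ->]; rewrite ?cosh_opp, ?sinh_opp, H;
      unfold Rdiv; ring.
Qed.

Lemma norm3_catX (c t theta : R) :
  norm3 (catX c t theta) = sqrt (c ^ 2 * (cosh t ^ 2 + t ^ 2)).
Proof.
  unfold norm3, dot, catX; f_equal; ring [(cos2_sin2 theta)].
Qed.

Lemma radius_condition_norm (T c : R) :
  radius_condition T c <-> c ^ 2 * (cosh T ^ 2 + T ^ 2) = 1.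
Proof.
  split.
  - intros H; pose proof PI_RGT_0.
    specialize (H T 0 ltac:(unfold param_bdry; lra)).
    rewrite norm3_catX in H.
    assert (Hn : 0 <= c ^ 2 * (cosh T ^ 2 + T ^ 2)) by nra.
    rewrite <- (sqrt_sqrt _ Hn), H; ring.
  - intros H t theta [Ht _]; rewrite norm3_catX, <- sqrt_1; f_equal.
    rewrite <- H; destruct Ht as [-> | ->]; rewrite ?cosh_opp; ring.
Qed.

Lemma radius_condition_iff (T c : R) :
  0 < T -> 0 < c -> cosh T = T * sinh T ->
  (radius_condition T c <-> c = 1 / (T * cosh T)).
Proof.
  intros HT Hc Hroot; rewrite radius_condition_norm.
  pose proof (cosh_pos T).
  assert (HTC : 0 < T * cosh T) by nra.
  (* Multiply [cosh T ^ 2 = 1 + sinh T ^ 2] by [T ^ 2] and use [T * sinh T = cosh T]. *)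
  assert (Hsq : cosh T ^ 2 + T ^ 2 = (T * cosh T) ^ 2).
  { rewrite Rpow_mult_distr, (cosh2_sinh2 T) at 1.
    pose proof (cosh2_sinh2 T); rewrite Hroot in *; nra. }
  rewrite Hsq; split; intros E.
  (* The square of [c * (T * cosh T)] is 1; positivity excludes the value -1. *)
  - assert (Hp : 0 < c * (T * cosh T)) by nra.
    assert (c * (T * cosh T) = 1) by nra.
    apply (Rmult_eq_reg_r (T * cosh T)); [field_simplify|]; lra.
  - rewrite E; field; lra.
Qed.

(** * The positive root of [cosh T = T * sinh T] *)

Lemma cosh_root_not_lt (T S : R) :
  0 < T -> cosh T = T * sinh T -> cosh S = S * sinh S -> ~ T < S.
Proof.
  intros HT ET ES Hlt.
  pose proof (sinh_pos T HT) as Hs.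
  pose proof (sinh_pos S ltac:(lra)) as Hs'.
  pose proof (sinh_pos (S - T) ltac:(lra)) as Hd.
  (* This leaves [0 < (T - S) * (sinh S * sinh T)], although [T - S] is negative. *)
  rewrite sinh_minus, ET, ES in Hd.
  assert (0 < sinh S * sinh T) by nra.
  nra.
Qed.

Lemma cosh_root_exists : exists T : R, 0 < T /\ cosh T = T * sinh T.
Proof.
  destruct (IVT (fun T => T * sinh T - cosh T) 0 2) as [T [HT E]].
  - intros x; apply continuity_pt_minus.
    + apply continuity_pt_mult.
      * apply continuity_pt_id.
      * apply derivable_continuous_pt, derivable_pt_sinh.
    + apply derivable_continuous_pt, derivable_pt_cosh.
  - lra.
  - rewrite cosh_0; lra.
  (* The value at 2 is [(exp 2 - 3 * exp (- 2)) / 2], positive because [exp 2 > 3] and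
     [exp (- 2) < 1]. *)
  - pose proof (exp_ineq1 2 ltac:(lra)).
    pose proof (exp_increasing (Ropp 2) 0 ltac:(lra)) as H0; rewrite exp_0 in H0.
    unfold sinh, cosh; lra.
  - exists T; split; [|lra].
    (* The interval is closed; its endpoint 0 is no root, the value there being -1. *)
    destruct HT as [[HT | <-] _]; [exact HT|].
    rewrite cosh_0 in E; lra.
Qed.

Lemma cosh_root_unique : exists! T : R, 0 < T /\ cosh T = T * sinh T.
Proof.
  destruct cosh_root_exists as [T [HT E]].
  exists T; split; [easy|].
  intros S [HS ES].
  pose proof (cosh_root_not_lt T S HT E ES).
  pose proof (cosh_root_not_lt S T HS ES E); lra.
Qed.

Theorem proposition6p1 :
  (* [catNu] is a unit normal of [Sigma_{T,c}], which is minimal *)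
  (forall T c t theta : R, 0 < T -> 0 < c -> param_dom T t theta ->
     unit_normal_at (catX c) catNu t theta /\
     mean_curvature (catX c) catNu t theta = 0) /\
  (* (i) *)
  (exists! T : R, 0 < T /\ cosh T = T * sinh T) /\
  (forall T c : R, 0 < T -> 0 < c ->
     (free_boundary T c <-> cosh T = T * sinh T)) /\
  (* (ii) *)
  (forall T c : R, 0 < T -> 0 < c -> free_boundary T c ->
     (radius_condition T c <-> c = 1 / (T * cosh T))) /\
  (* (iii) *)
  (forall T c : R, 0 < T -> 0 < c ->
     (forall t theta : R, param_dom T t theta ->
        jacobi_potential c t theta = 2 / cosh t ^ 2) /\
     (forall mu : R, potential_strength T c mu -> mu = 1)) /\
  (* no free parameter *)
  (exists! p : R * R * R,
     let '(T, c, mu) := p in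
     0 < T /\ 0 < c /\
     free_boundary T c /\ radius_condition T c /\ potential_strength T c mu).
Proof.
  split; [|split; [|split; [|split; [|split]]]].
  - intros T c t theta _ Hc _.
    auto using unit_normal_at_catX, mean_curvature_catX.
  - exact cosh_root_unique.
  - intros T c _ Hc; now apply free_boundary_iff.
  - intros T c HT Hc Hfb; apply radius_condition_iff; trivial.
    now apply (free_boundary_iff T c).
  - intros T c HT Hc; split.
    + intros t theta _; now apply jacobi_potential_eq.
    + intros mu; now apply potential_strength_iff.
  - destruct cosh_root_unique as [T [[HT E] Huniq]].
    assert (Hc : 0 < 1 / (T * cosh T)).
    { pose proof (cosh_pos T); apply Rdiv_lt_0_compat; nra. }
    exists (T, 1 / (T * cosh T), 1); split.
    + repeat split; trivial.
      * now apply free_boundary_iff.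
      * now apply radius_condition_iff.
      * now apply potential_strength_iff.
    + intros [[S d] mu] (HS & Hd & Hfb & Hr & Hmu).
      (* This comes first: the root equation for [S] is a premise of [radius_condition_iff]. *)
      apply free_boundary_iff in Hfb; trivial.
      apply radius_condition_iff in Hr; trivial.
      apply potential_strength_iff in Hmu; trivial.
      rewrite Hr, Hmu, (Huniq S (conj HS Hfb)); reflexivity.
Qed.
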